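(* Let $p$ be a prime with $p \equiv 5 \pmod 8$, and let $a, b \in \mathbb{Z}$ satisfy $a^2 \equiv -1 \pmod p$ and $8ab^2 \equiv 1 \pmod p$. For an integer $y$ define \[ x = \pm b\, y^{\frac{p+3}{8}}\left(1+y^{\frac{p-1}{2}}\right)\left(a+y^{\frac{p-1}{4}}\right) \bmod p . \] If $y$ is a quadratic residue modulo $p$, then $x^2 \equiv y \pmod p$, and if $y$ is a quadratic nonresidue modulo $p$, then $x \equiv 0 \pmod p$.
   Context: Quadratic residues and nonresidues modulo the odd prime $p$ are the nonzero classes $y$ with $y^{\frac{p-1}{2}} \equiv 1$ and $y^{\frac{p-1}{2}} \equiv -1 \pmod p$ respectively (Euler's criterion). The aim is a polynomial in $y$ over $\mathbb{Z}_p$ which returns a square root of $y$ when $y$ is a quadratic residue and returns $0$ when $y$ is a quadratic nonresidue. *)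

(* Defs.v *)
From mathcomp Require Import all_boot all_order all_algebra.
From mathcomp Require Import all_fingroup all_solvable all_field.

Set Implicit Arguments.
Unset Strict Implicit.
Unset Printing Implicit Defensive.

Import Order.TTheory GRing.Theory Num.Theory.
Local Open Scope ring_scope.

Definition quadratic_residue (p : nat) (y : int) : Prop :=
  ~~ (p %| y)%Z /\ exists z : int, (z ^+ 2 = y %[mod p])%Z.

Definition quadratic_nonresidue (p : nat) (y : int) : Prop :=
  ~~ (p %| y)%Z /\ ~ (exists z : int, (z ^+ 2 = y %[mod p])%Z).

Lemma eq_modz_Fp (p : nat) (m n : int) : prime p ->
  (m = n %[mod p])%Z <-> m%:~R = n%:~R :> 'F_p.
Proof.
move=> p_pr; have E : (m == n %[mod p])%Z = (m%:~R == n%:~R :> 'F_p).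
  by rewrite eqz_mod_dvd (dvdz_pcharf (pchar_Fp p_pr)) rmorphB /= subr_eq0.
by split=> /eqP h; apply/eqP; rewrite ?E // -E.
Qed.

Lemma Fp_expp1 (p : nat) (u : 'F_p) : prime p -> u != 0 -> u ^+ p.-1 = 1.
Proof.
move=> p_pr u0; apply: (mulfI u0).
rewrite mulr1 -exprS prednK ?prime_gt0 //.
by have := expf_card u; rewrite card_Fp.
Qed.

Lemma odd_half_pred (p : nat) : odd p -> (p.-1 = (p - 1) %/ 2 * 2)%N.
Proof. by case: p => // p /= /negbTE op; rewrite subn1 /= divnK // dvdn2 op. Qed.

Lemma Fp_Euler_sqrt (p : nat) (u : 'F_p) : prime p -> odd p -> u != 0 ->
  u ^+ ((p - 1) %/ 2) = 1 -> exists v : 'F_p, v ^+ 2 = u.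
Proof.
move=> p_pr op u0 u1.
have p1_gt0 : (0 < p.-1)%N by rewrite -subn1 subn_gt0 prime_gt1.
have /cyclicP[g genG] := field_unit_group_cyclic [set: {unit 'F_p}]%G.
have og : #[g]%g = p.-1 by rewrite /order -genG card_finField_unit card_Fp.
have uU : u \is a GRing.unit by rewrite unitfE.
pose U : {unit 'F_p} := Sub u uU.
have : U \in <[g]>%g by rewrite -genG inE.
case/cycleP=> k Uk.
have uk : u = val g ^+ k by rewrite -FinRing.val_unitX -Uk.
have : (#[g]%g %| k * ((p - 1) %/ 2))%N.
  by rewrite order_dvdn; apply/eqP/val_inj; rewrite FinRing.val_unitX exprM -uk u1.
rewrite og [in X in (X %| _)%N](odd_half_pred op) mulnC.
rewrite dvdn_pmul2r; last first.
  by move: p1_gt0; rewrite (odd_half_pred op); case: (_ %/ _)%N.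
by case/dvdnP=> j ej; exists (val g ^+ j); rewrite -exprM -ej -uk.
Qed.

(* The two Euler lemmas show that, for odd prime p, these definitions agree with
   the description of residues and nonresidues by y ^ ((p - 1) / 2) = 1 or -1. *)
Lemma quadratic_residue_Euler (p : nat) (y : int) : prime p -> odd p ->
  quadratic_residue p y <->
  ~~ (p %| y)%Z /\ (y ^+ ((p - 1) %/ 2)%N = 1 %[mod p])%Z.
Proof.
move=> p_pr op; rewrite /quadratic_residue (dvdz_pcharf (pchar_Fp p_pr)).
split=> -[y0 H]; split=> //.
  case: H => z /(eq_modz_Fp _ _ p_pr) zy; apply/(eq_modz_Fp _ _ p_pr).
  move: y0; rewrite !rmorphXn /= in zy *; rewrite -zy expf_eq0 /= => z0.
  by rewrite -exprM mulnC -(odd_half_pred op) Fp_expp1.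
move/(eq_modz_Fp _ _ p_pr): H; rewrite rmorphXn /= => H.
have [v vy] := Fp_Euler_sqrt p_pr op y0 H.
exists (v : nat)%:Z; apply/(eq_modz_Fp _ _ p_pr).
by rewrite rmorphXn /= -vy -pmulrn natr_Zp.
Qed.

Lemma quadratic_nonresidue_Euler (p : nat) (y : int) : prime p -> odd p ->
  quadratic_nonresidue p y <->
  ~~ (p %| y)%Z /\ (y ^+ ((p - 1) %/ 2)%N = -1 %[mod p])%Z.
Proof.
move=> p_pr op; have E := quadratic_residue_Euler y p_pr op.
split=> -[y0 H]; split=> //; last first.
  move=> exz; have [_] := E.1 (conj y0 exz); rewrite H.
  move/(eq_modz_Fp _ _ p_pr)/eqP; rewrite rmorphN1 rmorph1 eq_sym -addr_eq0.
  rewrite -mulr2n -(dvdn_pcharf (pchar_Fp p_pr)) => p2.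
  by move: p2 op; rewrite (dvdn_prime2 p_pr) // => /eqP->.
have := y0; rewrite (dvdz_pcharf (pchar_Fp p_pr)) => u0.
have /eqP := Fp_expp1 p_pr u0.
rewrite (odd_half_pred op) exprM sqrf_eq1 => /orP[]/eqP h.
  by case: H; apply: (E.2 _).2; split=> //; apply/(eq_modz_Fp _ _ p_pr); rewrite rmorphXn.
by apply/(eq_modz_Fp _ _ p_pr); rewrite rmorphXn rmorphN1.
Qed.

(* Main.v *)
Require Import Defs.
From mathcomp Require Import all_boot all_order all_algebra.
From mathcomp Require Import ring.
Import Order.TTheory GRing.Theory Num.Theory.
Local Open Scope ring_scope.

(** Write p = 8m + 5 and t = y^((p-1)/4) = y^(2m+1), so that
    y^((p-1)/2) = t^2 and (y^((p+3)/8))^2 = y^(2m+2) = y t. For a residue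
    t^2 = 1 cancels a^2 = -1 in (a + t)^2, leaving 2at; hence
    x^2 = b^2 (y t) 4 (2at) = (8ab^2) y t^2 = y. For a nonresidue the factor
    1 + t^2 vanishes. *)

Lemma sqrt_formula (R : comPzRingType) (a b s y : R) (m : nat) :
  a ^+ 2 = -1 -> 8 * a * b ^+ 2 = 1 -> s ^+ 2 = 1 ->
  y ^+ (4 * m + 2) = 1 ->
  (s * b * y ^+ m.+1 * (1 + y ^+ (4 * m + 2)) * (a + y ^+ (2 * m + 1))) ^+ 2
    = y.
Proof.
move=> a2 ab2 s2 y1; rewrite y1; set t := y ^+ (2 * m + 1).
have t2 : t ^+ 2 = 1 by rewrite -exprM mulnDl mulnAC.
have yt : (y ^+ m.+1) ^+ 2 = y * t by rewrite -exprM -exprS mulnC mulnS addnC addn2 addn1.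
have at2 : (a + t) ^+ 2 = 2 * a * t by rewrite sqrrD a2 t2; ring.
rewrite !exprMn s2 yt at2.
have -> : 1 * b ^+ 2 * (y * t) * (1 + 1) ^+ 2 * (2 * a * t)
          = 8 * a * b ^+ 2 * t ^+ 2 * y by ring.
by rewrite ab2 t2 !mul1r.
Qed.

Theorem theorem3 (p : nat) (a b : int) :
  prime p -> p = 5 %[mod 8] ->
  (a ^+ 2 = -1 %[mod p])%Z -> (8 * a * b ^+ 2 = 1 %[mod p])%Z ->
  forall (y s x : int), s = 1 \/ s = -1 ->
  x = ((s * b * y ^+ ((p + 3) %/ 8)%N * (1 + y ^+ ((p - 1) %/ 2)%N)
          * (a + y ^+ ((p - 1) %/ 4)%N)) %% p)%Z ->
  (quadratic_residue p y -> (x ^+ 2 = y %[mod p])%Z) /\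
  (quadratic_nonresidue p y -> (x = 0 %[mod p])%Z).
Proof.
move=> p_pr p5 a2 ab2 y s x s1 xE.
(* Congruences modulo [p] become equalities in ['F_p], a commutative ring to which [sqrt_formula]
   applies. *)
have toFp := fun m n => eq_modz_Fp m n p_pr.
have [m pE] : exists m, p = (8 * m + 5)%N.
  by exists (p %/ 8)%N; rewrite {1}(divn_eq p 8) p5 mulnC.
have e1 : ((p + 3) %/ 8 = m.+1)%N.
  by rewrite pE -addnA -mulnSr mulKn.
have e2 : ((p - 1) %/ 2 = 4 * m + 2)%N.
  (* Writing the right side as [2 * (4 * m + 2) %/ 2] leaves only the numerators to compare; [e4] is
     obtained likewise with 4. *)
  by rewrite pE -addnBA // -(@mulKn (4 * m + 2) 2) // mulnDr mulnA.
have e4 : ((p - 1) %/ 4 = 2 * m + 1)%N.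
  by rewrite pE -addnBA // -(@mulKn (2 * m + 1) 4) // mulnDr mulnA.
have op : odd p by rewrite pE oddD oddM.
(* [e2] is kept because Euler's criterion brings back the exponent [(p - 1) %/ 2] in both cases. *)
rewrite {}e1 e2 {}e4 in xE.
(* The outer reduction modulo [p] in [xE] disappears on passing to ['F_p]. *)
have /toFp xF : (x = s * b * y ^+ m.+1 * (1 + y ^+ (4 * m + 2))
                     * (a + y ^+ (2 * m + 1)) %[mod p])%Z by rewrite xE modz_mod.
split.
  case/(quadratic_residue_Euler y p_pr op) => _ /toFp; rewrite e2 => y1.
  apply/toFp; rewrite rmorphXn /= xF.
  rewrite !(rmorphM, rmorphD, rmorphXn, rmorph1) /= in y1 *.
  apply: sqrt_formula => //.
  - by move/toFp: a2; rewrite rmorphXn rmorphN1.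
  - by move/toFp: ab2; rewrite 2!rmorphM rmorphXn.
  - by case: s1 => ->; rewrite ?rmorphN1 ?sqrrN expr1n.
case/(quadratic_nonresidue_Euler y p_pr op) => _ /toFp; rewrite e2 => y1.
by apply/toFp; rewrite xF 2!rmorphM (rmorphD _ 1) /= y1 rmorphN1 rmorph1 subrr mulr0 mul0r.
Qed.
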